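(* Let $G$ be a graph in the class $\mathcal{G}$ with a basic clique cover $Q_1,\ldots,Q_k$ (where $k=\alpha(G)$). Then $G$ is well-covered if and only if for each $i$ with $1\le i\le k$ the following holds: whenever a set $A\subseteq V(G)\setminus Q_i$ dominates $Q_i$, the set $A$ is not an independent set.
   Context: Graphs are finite, with no loops or multiple edges. A set of vertices is independent if no two of its vertices are adjacent, and is a clique if every two distinct vertices in it are adjacent. $\alpha(G)$ denotes the largest cardinality of an independent set of $G$. $G$ is well-covered if all maximal (with respect to inclusion) independent sets of $G$ have the same cardinality. For $A,B\subseteq V(G)$, $A$ dominates $B$ if every vertex $v\in B$ is in $A$ or is adjacent to at least one vertex of $A$. The class $\mathcal{G}$ consists of all graphs $G$ for which there are $k=\alpha(G)$ cliques of $G$ whose union is $V(G)$. A basic clique cover of $G$ is a collection $Q_1,\ldots,Q_k$ of $k=\alpha(G)$ pairwise disjoint cliques with $Q_1\cup\cdots\cup Q_k=V(G)$; every graph in $\mathcal{G}$ has one. (Cliques are identified with their vertex sets.) *)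

(* Defs.v *)
From mathcomp Require Import all_boot.

Set Implicit Arguments.
Unset Strict Implicit.
Unset Printing Implicit Defensive.

Record sgraph := SGraph {
  vertex :> finType;
  adj : rel vertex;
  adj_sym : symmetric adj;
  adj_irrefl : irreflexive adj
}.

Definition independent (G : sgraph) (A : {set G}) : bool :=
  [forall u in A, forall v in A, ~~ adj u v].

Definition clique (G : sgraph) (A : {set G}) : bool :=
  [forall u in A, forall v in A, (u != v) ==> adj u v].

Definition alpha (G : sgraph) : nat :=
  \max_(A : {set G} | independent A) #|A|.

Definition well_covered (G : sgraph) : Prop :=
  forall A B : {set G},
    maxset (@independent G) A -> maxset (@independent G) B -> #|A| = #|B|.

Definition dominates (G : sgraph) (A B : {set G}) : Prop :=
  forall v, v \in B -> v \in A \/ exists2 u, u \in A & adj v u.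

(* The class \mathcal{G}: the cliques are not required to be disjoint. *)
Definition in_class_G (G : sgraph) : Prop :=
  exists Q : 'I_(alpha G) -> {set G},
    (forall i, clique (Q i)) /\ \bigcup_i Q i = [set: G].

(* Neither nonemptiness nor distinctness of the cliques is required: both
   follow, as a clique meets an independent set of size [alpha G] at most once. *)
Definition basic_clique_cover (G : sgraph) (k : nat) (Q : 'I_k -> {set G})
    : Prop :=
  [/\ k = alpha G,
      forall i, clique (Q i),
      forall i j, i != j -> [disjoint Q i & Q j]
    & \bigcup_i Q i = [set: G]].

(* Main.v *)
(* An independent set meets each clique of the cover at most once, so its size
   is the number of cliques it meets, and it has size k = alpha(G) exactly when
   it meets all of them. A maximal independent set missing Q_i dominates Q_i;
   conversely, any independent extension of an independent set that dominates
   Q_i from outside still misses Q_i. *)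
Require Import Defs.
From mathcomp Require Import all_boot.

Lemma independentP (G : sgraph) (A : {set G}) :
  reflect {in A &, forall u v, ~~ adj u v} (independent A).
Proof.
apply: (iffP idP) => [/forall_inP indA u v uA vA | indA].
  exact: (forall_inP (indA u uA)).
by apply/forall_inP => u uA; apply/forall_inP => v vA; apply: indA.
Qed.

Lemma cliqueP (G : sgraph) (A : {set G}) :
  reflect {in A &, forall u v, u != v -> adj u v} (clique A).
Proof.
apply: (iffP idP) => [/forall_inP clA u v uA vA | clA].
  exact: (implyP (forall_inP (clA u uA) v vA)).
apply/forall_inP => u uA; apply/forall_inP => v vA; apply/implyP.
exact: clA.
Qed.

Lemma independent0 (G : sgraph) : independent (set0 : {set G}).
Proof. by apply/independentP => u v; rewrite inE. Qed.

Lemma independentU1 (G : sgraph) (A : {set G}) (v : G) :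
  independent A -> {in A, forall u, ~~ adj v u} -> independent (v |: A).
Proof.
move=> /independentP indA nvA; apply/independentP => x y.
rewrite !in_setU1 => /predU1P[->|xA] /predU1P[->|yA].
- by rewrite adj_irrefl.
- exact: nvA.
- by rewrite adj_sym; apply: nvA.
- exact: indA.
Qed.

(** A vertex outside [A] with no neighbour in [A] could be added to [A], against maximality; so [A]
    dominates all of [G], whatever [B] is. *)
Lemma maxset_independent_dominates (G : sgraph) (A B : {set G}) :
  maxset (@independent G) A -> dominates A B.
Proof.
move=> /maxsetP[indA maxA] v _.
have [vA|vNA] := boolP (v \in A); [by left | right].
have [/exists_inP //|nvA] := boolP [exists u in A, adj v u].
rewrite negb_exists_in in nvA.
have indvA := independentU1 G A v indA (forall_inP nvA).
by rewrite -(maxA _ indvA (subsetUr _ _)) setU11 in vNA.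
Qed.

Lemma card_independent_clique (G : sgraph) (A C : {set G}) :
  independent A -> clique C -> #|A :&: C| <= 1.
Proof.
move=> /independentP indA /cliqueP clC; apply/card_le1_eqP => u v.
rewrite !inE => /andP[uA uC] /andP[vA vC]; apply/eqP/contraT => uv.
by have := indA v u vA uA; rewrite clC.
Qed.

(** Links the two notions of largest: in a well-covered graph this one set [M] forces the common
    size to be [alpha G]. *)
Lemma maxset_maximum_independent (G : sgraph) :
  exists2 M : {set G}, maxset (@independent G) M & #|M| = alpha G.
Proof.
have [|M indM alphaM] := @eq_bigmax_cond _ (@independent G) (fun A => #|A|).
  (* The maximum is attained only over a nonempty family; the empty set provides a member. *)
  by apply/card_gt0P; exists set0; apply: independent0.
exists M => //; apply/maxsetP; split=> // B indB sMB; apply/esym/eqP.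
by rewrite eqEcard sMB -alphaM; apply: leq_bigmax_cond.
Qed.

Lemma card_independent_cover (G : sgraph) (k : nat) (Q : 'I_k -> {set G})
    (A : {set G}) :
  basic_clique_cover Q -> independent A ->
  #|A| = #|[set i | A :&: Q i != set0]|.
Proof.
case=> _ clQ disjQ covQ indA.
have -> : #|A| = \sum_i #|A :&: Q i|.
  (* The cover splits [A] into the pairwise disjoint pieces [A :&: Q i]. *)
  rewrite -{1}(setIT A) -covQ big_distrr /= -sum1_card.
  rewrite partition_disjoint_bigcup => [|i j ij].
    by apply: eq_bigr => i _; rewrite sum1_card.
  by apply: disjointW (disjQ i j ij); apply: subsetIr.
(* Termwise comparison: a piece of size at most 1 has as its size the indicator of being
   nonempty. *)
rewrite -sum1dep_card [RHS]big_mkcond /=; apply: eq_bigr => i _.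
have := card_independent_clique _ _ _ indA (clQ i).
by rewrite -card_gt0; case: #|_| => [|[]].
Qed.

Lemma card_independent_cover_eq (G : sgraph) (k : nat) (Q : 'I_k -> {set G})
    (A : {set G}) :
  basic_clique_cover Q -> independent A ->
  #|A| = k <-> (forall i, A :&: Q i != set0).
Proof.
move=> hQ indA; rewrite (card_independent_cover _ _ _ _ hQ indA).
split=> [cardk i | meetA].
  (* A set of [k] indices in ['I_k] contains every index. *)
  suff /setP/(_ i): [set i | A :&: Q i != set0] = setT by rewrite !inE.
  by apply/eqP; rewrite eqEcard subsetT cardsT card_ord cardk leqnn.
by rewrite -[RHS]card_ord -cardsT; congr #|pred_of_set _|; apply/setP=> i;
  rewrite !inE meetA.
Qed.

Theorem theorem2p2 (G : sgraph) (hG : in_class_G G)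
    (k : nat) (Q : 'I_k -> {set G}) (hQ : basic_clique_cover Q) :
  well_covered G <->
  (forall (i : 'I_k) (A : {set G}),
     A \subset ~: Q i -> dominates A (Q i) -> ~ independent A).
Proof.
have k_alpha : k = alpha G by case: hQ.
split=> [wcG i A sAQ domA indA | noDom].
  have [B maxB sAB] := maxset_exists indA.
  have /independentP indB := maxsetp maxB.
  have [M maxM cardM] := maxset_maximum_independent G.
  have cardB : #|B| = k by rewrite (wcG _ _ maxB maxM) cardM.
  have /set0Pn[v] :=
    (card_independent_cover_eq _ _ _ _ hQ (maxsetp maxB)).1 cardB i.
  rewrite inE => /andP[vB vQ].
  (* Either [v] lies in [A], which avoids [Q i], or [v] has a neighbour [u] in [A], and then [B]
     contains the adjacent pair [u], [v]. *)
  have [vA|[u uA vu]] := domA v vQ.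
    by have := subsetP sAQ v vA; rewrite inE vQ.
  by have := indB v u vB (subsetP sAB u uA); rewrite vu.
suff maxk A : maxset (@independent G) A -> #|A| = k.
  by move=> A B /maxk-> /maxk->.
move=> maxA; apply/(card_independent_cover_eq _ _ _ _ hQ (maxsetp maxA)) => i.
(* If [A] missed [Q i], it would be an independent set dominating [Q i] from outside. *)
apply/negP; rewrite setI_eq0 disjoints_subset => sAQ.
exact: noDom sAQ (maxset_independent_dominates _ _ _ maxA) (maxsetp maxA).
Qed.
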